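(* Let $0<\alpha\leq 1$. For any metric space $(X,d)$, $C_0(X,d^\alpha)\leq 2^\alpha$, where $d^\alpha(x,y)=d(x,y)^\alpha$.
   Context: For a metric space $(X,d)$ and $\mu \geq 0$, say that $(X,d)$ satisfies the $(\mu,0)$-four-point inequality if for all $x,y,z,w\in X$, $d(x,y)+d(z,w)\le \mu\max\{d(x,z)+d(y,w),\ d(x,w)+d(y,z)\}$. The quadrilateral constant of $(X,d)$ is $C_0(X,d)=\inf\{\mu\geq 0 \mid (X,d)\text{ satisfies the }(\mu,0)\text{-four-point inequality}\}$. For $0<\alpha\leq 1$ the function $d^\alpha$ is again a metric on $X$; $(X,d^\alpha)$ is called the $\alpha$-snowflake of $(X,d)$. *)

(* Defs.v *)
From HB Require Import structures.
From mathcomp Require Import all_boot all_order all_algebra.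
From mathcomp Require Import all_classical all_reals all_analysis.

Set Implicit Arguments.
Unset Strict Implicit.
Unset Printing Implicit Defensive.

Import Order.TTheory GRing.Theory Num.Theory.

Local Open Scope classical_set_scope.
Local Open Scope ring_scope.

(* The distance is an explicit argument, so that several metrics on the same
   set can be considered, in particular the snowflakes of a given one. *)

(* The (mu, 0)-four-point inequality. *)
Definition four_point (R : realType) (X : Type) (mu : R) (d : X -> X -> R) :
    Prop :=
  forall x y z w : X,
    d x y + d z w <= mu * Num.max (d x z + d y w) (d x w + d y z).

(* The infimum is taken in the extended reals, where the infimum of the empty
   set is +oo; the infimum in R would be 0 there. *)
Definition quad_const (R : realType) (X : Type) (d : X -> X -> R) : \bar R :=
  ereal_inf [set mu%:E | mu in [set mu : R | 0 <= mu /\ four_point mu d]].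

Definition snowflake (R : realType) (X : Type) (alpha : R) (d : X -> X -> R) :
    X -> X -> R :=
  fun x y => d x y `^ alpha.

(* Main.v *)
Require Import Defs.
From mathcomp Require Import all_boot all_order all_algebra.
From mathcomp Require Import all_classical all_reals all_analysis.

(** View [x z y w] as a quadrilateral with sides [xz], [zy], [yw], [wx] and
    diagonals [xy], [zw]; the two terms of the maximum in the four-point
    inequality are the sums over the two pairs of opposite sides. Take a shortest
    side. Each of its two neighbours spans with it a triangle whose third edge
    is a diagonal, so the triangle inequality bounds that diagonal by twice the
    neighbour ([mdist_le_double]). The neighbours are opposite to each other and
    the two diagonals so obtained are distinct; hence raising to the power
    [alpha] and adding gives the four-point inequality with the constant
    [2 `^ alpha], already for one of the two terms of the maximum. *)

Set Implicit Arguments.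
Unset Strict Implicit.
Unset Printing Implicit Defensive.

Import Order.TTheory GRing.Theory Num.Theory.

Local Open Scope ring_scope.

Lemma mdist_le_double (R : realType) (X : metricType R) (x y z : X) :
  mdist y z <= mdist x z -> mdist x y <= 2 * mdist x z.
Proof.
move=> yz_le_xz; apply: (le_trans (metric_triangle x z y)).
by rewrite mulr_natl mulr2n lerD2l metric_sym.
Qed.

Lemma snowflake_le_double (R : realType) (alpha : R) (X : metricType R)
    (x y z : X) :
  0 <= alpha -> mdist y z <= mdist x z ->
  snowflake alpha (@mdist R X) x y
    <= 2 `^ alpha * snowflake alpha (@mdist R X) x z.
Proof.
move=> alpha_ge0 yz_le_xz; rewrite /snowflake -powRM ?mdist_ge0//.
by rewrite ge0_ler_powR ?nnegrE ?mulr_ge0 ?mdist_ge0// mdist_le_double.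
Qed.

Lemma snowflake_sym (R : realType) (alpha : R) (X : metricType R) (x y : X) :
  snowflake alpha (@mdist R X) x y = snowflake alpha (@mdist R X) y x.
Proof. by rewrite /snowflake metric_sym. Qed.

(** The side [yz] forms the triangle [xyz] with [xz] and the diagonal [xy], and
    the triangle [yzw] with [yw] and the diagonal [zw]. *)
Lemma snowflake_diagonals_le (R : realType) (alpha : R) (X : metricType R)
    (x y z w : X) :
  0 <= alpha -> mdist y z <= mdist x z -> mdist y z <= mdist y w ->
  snowflake alpha (@mdist R X) x y + snowflake alpha (@mdist R X) z w
    <= 2 `^ alpha * (snowflake alpha (@mdist R X) x z
                     + snowflake alpha (@mdist R X) y w).
Proof.
move=> alpha_ge0 yz_le_xz yz_le_yw; rewrite mulrDr lerD ?snowflake_le_double//.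
rewrite (snowflake_sym _ z) (snowflake_sym _ y) snowflake_le_double//.
by rewrite metric_sym (metric_sym w).
Qed.

Lemma snowflake_four_point (R : realType) (alpha : R) (X : metricType R) :
  0 <= alpha -> four_point (2 `^ alpha) (snowflake alpha (@mdist R X)).
Proof.
move=> alpha_ge0 x y z w.
(* Exchanging [z] and [w] permutes the two pairs of opposite sides. *)
wlog min_le : z w / Num.min (mdist x w) (mdist y z)
                    <= Num.min (mdist x z) (mdist y w).
  have [|/ltW] :=
    leP (Num.min (mdist x w) (mdist y z)) (Num.min (mdist x z) (mdist y w)).
    by move=> + wlog_le; exact: wlog_le.
  by move=> ge_min wlog_le; rewrite (snowflake_sym _ z w) maxC wlog_le.
(* Exchanging [x] with [y] and [z] with [w] maps each side to the opposite one,
   so it preserves the two pairs. *)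
wlog yz_le_xw : x y z w min_le / mdist y z <= mdist x w.
  have [|/ltW] := leP (mdist y z) (mdist x w).
    by move=> + wlog_le; exact: wlog_le.
  move=> xw_le_yz wlog_le; rewrite (snowflake_sym _ x y) (snowflake_sym _ z w).
  rewrite [X in Num.max X _]addrC [X in Num.max _ X]addrC wlog_le//.
  by rewrite minC [leRHS]minC.
move: min_le; rewrite (min_idPr yz_le_xw) le_min => /andP[yz_le_xz yz_le_yw].
apply: le_trans (snowflake_diagonals_le alpha_ge0 yz_le_xz yz_le_yw) _.
by rewrite ler_wpM2l ?powR_ge0// le_max lexx.
Qed.

Theorem theorem6p2 (R : realType) (alpha : R)
    (alpha_gt0 : 0 < alpha) (alpha_le1 : alpha <= 1) (X : metricType R) :
  (quad_const (snowflake alpha (@mdist R X)) <= (2 `^ alpha)%:E)%E.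
Proof.
apply: ereal_inf_lbound; exists (2 `^ alpha) => //; split.
  exact: powR_ge0.
exact/snowflake_four_point/ltW.
Qed.
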